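(* Let $D,E$ be operators, $\langle W|$ a row vector and $|V\rangle$ a column vector satisfying $$DE-qED=D+E,\qquad \langle W|E=\langle W|,\qquad D|V\rangle=|V\rangle,\qquad \langle W|V\rangle=1 ,$$ and put $$\hat D = \frac{q-1}q D + \frac 1q, \qquad \hat E = \frac{q-1}q E + \frac 1q .$$ Then for every integer $n\ge 0$, $\langle W|(y\hat D + \hat E)^n|V\rangle$ is equal to the sum of the weights $w(R)$ of all rook placements $R$ of half-perimeter $n$.
   Context: $q$ and $y$ are commuting indeterminates (scalars). $D,E$ are linear operators on a vector space over a field containing $\mathbb{Q}(q,y)$, $|V\rangle$ is a vector of that space, $\langle W|$ is a linear functional on it; scalars such as $\frac1q$ in the definition of $\hat D,\hat E$ stand for that multiple of the identity. Young diagrams are drawn in the French convention (rows left-justified, row lengths weakly decreasing from bottom to top), and rows and columns of length $0$ are allowed: a Young diagram of half-perimeter $n$ is determined by its north-east boundary, a lattice path of $n$ east and south unit steps from its top-left corner to its bottom-right corner, each east step corresponding to a column and each south step to a row (so half-perimeter = number of rows + number of columns). A rook placement of shape $\lambda$, where $\lambda$ is a Young diagram, is a partial filling of the cells of $\lambda$ with rooks such that there is at most one rook in each row and at most one rook in each column; its half-perimeter is that of $\lambda$. A cell of $\lambda$ contains a cross if it does not contain a rook, is not below a rook in the same column, and is not to the left of a rook in the same row. The weight of a rook placement $R$ with $r$ rooks, $s$ crosses and $t$ columns is $w(R)=p^rq^sy^t$, where $p=\frac{1-q}{q^2}$. *)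

(* Defs.v *)
From HB Require Import structures.
From mathcomp Require Import all_boot all_order all_algebra.
Set Implicit Arguments.
Unset Strict Implicit.
Unset Printing Implicit Defensive.
Import GRing.Theory.
Local Open Scope ring_scope.

(* The field Q(q,y), built as Frac(Q[q][y]): q is the inner variable and y the
   outer one. *)
Definition Qqy : fieldType := {fraction {poly {poly rat}}}.
Definition indet_q : Qqy := FracField.tofrac ('X%:P).
Definition indet_y : Qqy := FracField.tofrac 'X.

Section RookPlacements.

(* French convention: rows are numbered from bottom to top and columns from
   left to right.  A Young diagram with r rows and c columns is given by its r
   row lengths, all at most c.  Rows of length 0 are allowed, and so are empty
   columns, because c may exceed the length of the bottom row. *)
Variables r c : nat.
Implicit Types (lam : {ffun 'I_r -> 'I_c.+1}) (R : {set 'I_r * 'I_c}).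

Definition young lam : bool :=
  [forall i : 'I_r, forall i' : 'I_r, (i <= i')%N ==> (lam i' <= lam i)%N].

Definition cells lam : {set 'I_r * 'I_c} := [set x : 'I_r * 'I_c | (x.2 < lam x.1)%N].

Definition rook_placement lam R : bool :=
  [&& R \subset cells lam,
      [forall i, #|[set j | (i, j) \in R]| <= 1]%N &
      [forall j, #|[set i | (i, j) \in R]| <= 1]%N].

Definition below_rook R (x : 'I_r * 'I_c) : bool :=
  [exists i : 'I_r, (x.1 < i)%N && ((i, x.2) \in R)].

Definition left_of_rook R (x : 'I_r * 'I_c) : bool :=
  [exists j : 'I_c, (x.2 < j)%N && ((x.1, j) \in R)].

Definition crosses lam R : {set 'I_r * 'I_c} :=
  [set x in cells lam | [&& x \notin R, ~~ below_rook R x & ~~ left_of_rook R x]].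

Definition weight (K : fieldType) (q y : K) lam R : K :=
  ((1 - q) / q ^+ 2) ^+ #|R| * q ^+ #|crosses lam R| * y ^+ c.

End RookPlacements.

Definition rook_sum (K : fieldType) (q y : K) (n : nat) : K :=
  \sum_(r < n.+1) \sum_(c < n.+1 | (r + c == n)%N)
    \sum_(lam : {ffun 'I_r -> 'I_c.+1} | young lam)
      \sum_(R : {set 'I_r * 'I_c} | rook_placement lam R) weight q y lam R.

Definition hat_op (K : fieldType) (V : lmodType K) (q : K) (A : V -> V) : V -> V :=
  ((q - 1) / q \*: A) \+ (1 / q \*: idfun).

(* Main.v *)
Require Import Defs.
From HB Require Import structures.
From mathcomp Require Import all_boot all_order all_algebra.
From mathcomp Require Import ring.
Import GRing.Theory.
Local Open Scope ring_scope.

(** Write A and B for the hatted operators. The constant and the linear terms of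
    the hatting are tuned so that the affine relation between D and E becomes
    the q-Weyl relation A B = q B A + p with p = (1 - q) / q^2, while B still
    fixes the functional W and A still fixes v. So it suffices to normally order
    (y A + B)^n: once every A is moved to the right and absorbed by v, what is
    left is a combination of the vectors B^k v, and W sends each of them to 1.

    Rook placements record this normal ordering. A word in A and B is the
    boundary path of a diagram (A is an east step, that is a column, and B is a
    south step, that is a row), and a cell is a pair consisting of an A and a B
    further to the right. When that A passes that B, the term p erases both (a
    rook) and the term q B A exchanges them (a cross); a cell is left blank when
    one of its two letters has already been erased. The rows without a rook are
    the letters B that survive, so the vector version of the claim is

      (y A + B)^n v = sum over R of w(R) B^(number of free rows of R) v.

    It is proved by induction on n, according to the first step of the path
    (iter_rook_vector):
    - a first step south is an empty top row; it adds one free row and changes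
      neither rooks nor crosses, so it acts as B (shape_vector_add_row);
    - a first step east is a full left column. It carries no rook, and then has
      a cross in each free row, or one rook in a free row, and then has a cross
      in each free row above that rook. With k free rows these choices have
      total weight q^k for k remaining free rows and p (1 + q + ... + q^(k-1))
      for k - 1 remaining free rows, which are the coefficients of A B^k v
      (lower_iter). So it acts as y A (shape_vector_add_col). *)

Section Diagrams.
Set Implicit Arguments.
Unset Strict Implicit.

(** * Counting and quantifying by a distinguished row or column *)

Lemma card_sum_mem (T : finType) (A : {set T}) :
  #|A| = (\sum_x (x \in A))%N.
Proof. by rewrite -sum1_card big_mkcond. Qed.

Lemma card_sum_mem2 (S T : finType) (A : {set S * T}) :
  #|A| = (\sum_i \sum_j ((i, j) \in A))%N.
Proof.
by rewrite card_sum_mem pair_bigA; apply: eq_bigr => -[].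
Qed.

Lemma card_split_row r c (h : 'I_r.+1) (A : {set 'I_r.+1 * 'I_c}) :
  #|A| = (#|[set j | (h, j) \in A]| + #|[set x | (lift h x.1, x.2) \in A]|)%N.
Proof.
rewrite card_sum_mem2 (bigD1_ord h) //= card_sum_mem card_sum_mem2.
by congr addn; do ?[apply: eq_bigr => ? _]; rewrite ?inE.
Qed.

Lemma card_split_col r c (h : 'I_c.+1) (A : {set 'I_r * 'I_c.+1}) :
  #|A| = (#|[set i | (i, h) \in A]| + #|[set x | (x.1, lift h x.2) \in A]|)%N.
Proof.
rewrite card_sum_mem2; under eq_bigr do rewrite (bigD1_ord h) //=.
rewrite big_split /= card_sum_mem card_sum_mem2.
by congr addn; do ?[apply: eq_bigr => ? _]; rewrite ?inE.
Qed.

Lemma card_split_ord n (h : 'I_n.+1) (A : {set 'I_n.+1}) :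
  #|A| = ((h \in A) + #|[set i | lift h i \in A]|)%N.
Proof.
rewrite !card_sum_mem (bigD1_ord h) //=; congr addn.
by apply: eq_bigr => i _; rewrite inE.
Qed.

Lemma forall_lift n (h : 'I_n.+1) (P : pred 'I_n.+1) :
  [forall i, P i] = P h && [forall i, P (lift h i)].
Proof.
apply/forallP/andP => [P_all | [Ph /forallP Plift] i].
  by split=> //; apply/forallP.
by case: (unliftP h i) => [j|] ->.
Qed.

Lemma exists_lift n (h : 'I_n.+1) (P : pred 'I_n.+1) :
  [exists i, P i] = P h || [exists i, P (lift h i)].
Proof.
apply: negb_inj; rewrite negb_or !negb_exists.
exact: (forall_lift h (fun i => ~~ P i)).
Qed.

(** * Rooks row by row, free rows *)

Definition row_rooks r c (R : {set 'I_r * 'I_c}) i := [set j | (i, j) \in R].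
Definition col_rooks r c (R : {set 'I_r * 'I_c}) j := [set i | (i, j) \in R].

Definition free_rows r c (R : {set 'I_r * 'I_c}) : {set 'I_r} :=
  [set i | #|row_rooks R i| == 0%N].

Lemma rook_placementE r c (lam : {ffun 'I_r -> 'I_c.+1}) R :
  rook_placement lam R =
  [&& [forall i, forall j, ((i, j) \in R) ==> (j < lam i)%N],
      [forall i, #|row_rooks R i| <= 1]%N & [forall j, #|col_rooks R j| <= 1]%N].
Proof.
congr (_ && _); apply/subsetP/'forall_forallP => [sRl i j | sRl [i j] Rij].
  by apply/implyP => /sRl; rewrite inE.
by rewrite inE; apply: (implyP (sRl i j)).
Qed.

Lemma mem_crosses r c (lam : {ffun 'I_r -> 'I_c.+1}) R i j :
  ((i, j) \in crosses lam R) =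
  [&& (j < lam i)%N, (i, j) \notin R, ~~ below_rook R (i, j) & ~~ left_of_rook R (i, j)].
Proof. by rewrite in_set inE. Qed.

(** The additive form, rather than a formula for the number of free rows, lets
    the effect of an added row or column on that number be obtained by
    cancellation from its effect on the number of rooks. *)
Lemma card_free_rows r c (lam : {ffun 'I_r -> 'I_c.+1}) R :
  rook_placement lam R -> (#|R| + #|free_rows R|)%N = r.
Proof.
rewrite rook_placementE => /and3P[_ /forallP row_le1 _].
rewrite card_sum_mem2 card_sum_mem -big_split /= -[RHS]card_ord -sum1_card.
apply: eq_bigr => i _; rewrite inE; have := row_le1 i.
rewrite [#|row_rooks R i|]card_sum_mem.
under eq_bigr do rewrite inE.
by case: (\sum_j _)%N => [|[|]].
Qed.

(** * Adjoining an empty top row *)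

Definition add_row r c (lam : {ffun 'I_r -> 'I_c.+1}) : {ffun 'I_r.+1 -> 'I_c.+1} :=
  [ffun i => if unlift ord_max i is Some i' then lam i' else ord0].
Definition pad_row r c (R : {set 'I_r * 'I_c}) : {set 'I_r.+1 * 'I_c} :=
  [set x | if unlift ord_max x.1 is Some i then (i, x.2) \in R else false].

Lemma add_row_max r c (lam : {ffun 'I_r -> 'I_c.+1}) : add_row lam ord_max = ord0.
Proof. by rewrite ffunE unlift_none. Qed.

Lemma add_row_lift r c (lam : {ffun 'I_r -> 'I_c.+1}) i :
  add_row lam (lift ord_max i) = lam i.
Proof. by rewrite ffunE liftK. Qed.

Lemma young_add_row r c (lam : {ffun 'I_r -> 'I_c.+1}) :
  young (add_row lam) = young lam.
Proof.
rewrite /young (forall_lift ord_max); set top := (X in X && _).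
have -> : top.
  apply/forallP => i; rewrite add_row_max; apply/implyP => le_i.
  case: (unliftP ord_max i) le_i => [k|] ->; last by rewrite add_row_max.
  by rewrite lift_max leqNgt /= ltn_ord.
apply: eq_forallb => i; rewrite (forall_lift ord_max) add_row_max leq0n implybT.
by apply: eq_forallb => i'; rewrite !add_row_lift !lift_max.
Qed.

Lemma mem_pad_row_max r c (R : {set 'I_r * 'I_c}) j : ((ord_max, j) \in pad_row R) = false.
Proof. by rewrite inE unlift_none. Qed.

Lemma mem_pad_row_lift r c (R : {set 'I_r * 'I_c}) i j :
  ((lift ord_max i, j) \in pad_row R) = ((i, j) \in R).
Proof. by rewrite inE liftK. Qed.

Lemma row_rooks_pad_row_max r c (R : {set 'I_r * 'I_c}) :
  row_rooks (pad_row R) ord_max = set0.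
Proof. by apply/setP => j; rewrite !inE unlift_none. Qed.

Lemma row_rooks_pad_row_lift r c (R : {set 'I_r * 'I_c}) i :
  row_rooks (pad_row R) (lift ord_max i) = row_rooks R i.
Proof. by apply/setP => j; rewrite !inE liftK. Qed.

Lemma card_col_rooks_pad_row r c (R : {set 'I_r * 'I_c}) j :
  #|col_rooks (pad_row R) j| = #|col_rooks R j|.
Proof.
rewrite (card_split_ord ord_max) inE mem_pad_row_max.
by apply: eq_card => i; rewrite !inE liftK.
Qed.

Lemma card_pad_row r c (R : {set 'I_r * 'I_c}) : #|pad_row R| = #|R|.
Proof.
rewrite (card_split_row ord_max) -/(row_rooks _ _) row_rooks_pad_row_max cards0.
by apply: eq_card => -[i j]; rewrite inE mem_pad_row_lift.
Qed.

Lemma rook_placement_add_row r c (lam : {ffun 'I_r -> 'I_c.+1}) R :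
  rook_placement (add_row lam) (pad_row R) = rook_placement lam R.
Proof.
rewrite !rook_placementE; congr [&& _, _ & _].
- rewrite (forall_lift ord_max) andbC; under eq_forallb do under eq_forallb do
    rewrite mem_pad_row_lift add_row_lift.
  by case: forallP => // _; apply/forallP => j; rewrite mem_pad_row_max.
- rewrite (forall_lift ord_max) row_rooks_pad_row_max cards0 /=.
  by apply: eq_forallb => i; rewrite row_rooks_pad_row_lift.
by apply: eq_forallb => j; rewrite card_col_rooks_pad_row.
Qed.

(** The rooks lie in cells and the top row has none, so padding is onto the
    placements of the enlarged diagram; this makes it a change of index. *)
Lemma pad_row_restrict r c (lam : {ffun 'I_r -> 'I_c.+1}) R :
  rook_placement (add_row lam) R ->
  pad_row [set x | (lift ord_max x.1, x.2) \in R] = R.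
Proof.
rewrite rook_placementE => /andP[/'forall_forallP sRl _].
apply/setP => -[i j]; case: (unliftP ord_max i) => [k|] ->.
  by rewrite mem_pad_row_lift inE.
rewrite mem_pad_row_max; apply/esym/negP => Rj.
by have := implyP (sRl ord_max j) Rj; rewrite add_row_max.
Qed.

Lemma card_crosses_add_row r c (lam : {ffun 'I_r -> 'I_c.+1}) R :
  #|crosses (add_row lam) (pad_row R)| = #|crosses lam R|.
Proof.
rewrite (card_split_row ord_max).
have -> : [set j | (ord_max, j) \in crosses (add_row lam) (pad_row R)] = set0.
  by apply/setP => j; rewrite !inE add_row_max.
rewrite cards0; apply: eq_card => -[i j].
rewrite inE !mem_crosses /fst /snd add_row_lift mem_pad_row_lift.
congr [&& _, _, ~~ _ & ~~ _].
  rewrite /below_rook (exists_lift ord_max) mem_pad_row_max andbF.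
  by apply: eq_existsb => i'; rewrite mem_pad_row_lift /fst !lift_max.
by apply: eq_existsb => j'; rewrite mem_pad_row_lift.
Qed.

(** * Adjoining a full left column *)

Definition add_col r c (lam : {ffun 'I_r -> 'I_c.+1}) : {ffun 'I_r -> 'I_c.+2} :=
  [ffun i => lift ord0 (lam i)].
Definition pad_col r c (C : {set 'I_r}) (R : {set 'I_r * 'I_c}) : {set 'I_r * 'I_c.+1} :=
  [set x | if unlift ord0 x.2 is Some j then (x.1, j) \in R else x.1 \in C].

Lemma add_colE r c (lam : {ffun 'I_r -> 'I_c.+1}) i : add_col lam i = (lam i).+1 :> nat.
Proof. by rewrite ffunE lift0. Qed.

Lemma young_add_col r c (lam : {ffun 'I_r -> 'I_c.+1}) :
  young (add_col lam) = young lam.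
Proof.
by apply: eq_forallb => i; apply: eq_forallb => i'; rewrite !add_colE.
Qed.

Lemma mem_pad_col0 r c C (R : {set 'I_r * 'I_c}) i :
  ((i, ord0) \in pad_col C R) = (i \in C).
Proof. by rewrite inE unlift_none. Qed.

Lemma mem_pad_col_lift r c C (R : {set 'I_r * 'I_c}) i j :
  ((i, lift ord0 j) \in pad_col C R) = ((i, j) \in R).
Proof. by rewrite inE liftK. Qed.

Lemma pad_colK r c (R : {set 'I_r * 'I_c.+1}) :
  pad_col (col_rooks R ord0) [set x | (x.1, lift ord0 x.2) \in R] = R.
Proof.
apply/setP => -[i j]; case: (unliftP ord0 j) => [k|] ->.
  by rewrite mem_pad_col_lift inE.
by rewrite mem_pad_col0 inE.
Qed.

Lemma col_rooks_pad_col0 r c C (R : {set 'I_r * 'I_c}) : col_rooks (pad_col C R) ord0 = C.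
Proof. by apply/setP => i; rewrite inE mem_pad_col0. Qed.

Lemma col_rooks_pad_col_lift r c C (R : {set 'I_r * 'I_c}) j :
  col_rooks (pad_col C R) (lift ord0 j) = col_rooks R j.
Proof. by apply/setP => i; rewrite inE mem_pad_col_lift inE. Qed.

Lemma pad_col_restrict r c C (R : {set 'I_r * 'I_c}) :
  [set x | (x.1, lift ord0 x.2) \in pad_col C R] = R.
Proof. by apply/setP => -[i j]; rewrite inE mem_pad_col_lift. Qed.

Lemma card_row_rooks_pad_col r c C (R : {set 'I_r * 'I_c}) i :
  #|row_rooks (pad_col C R) i| = ((i \in C) + #|row_rooks R i|)%N.
Proof.
rewrite (card_split_ord ord0) inE mem_pad_col0; congr addn.
by apply: eq_card => j; rewrite !inE liftK.
Qed.

Lemma card_pad_col r c C (R : {set 'I_r * 'I_c}) : #|pad_col C R| = (#|C| + #|R|)%N.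
Proof.
rewrite (card_split_col ord0) -/(col_rooks _ _) col_rooks_pad_col0; congr addn.
by rewrite pad_col_restrict.
Qed.

(** [C] is the set of rows whose rook is in the new column: at most one of them
    by the column condition, and a free one by the row condition. *)
Lemma rook_placement_add_col r c (lam : {ffun 'I_r -> 'I_c.+1}) (C : {set 'I_r}) R :
  rook_placement (add_col lam) (pad_col C R) =
  rook_placement lam R && ((C \subset free_rows R) && (#|C| <= 1)%N).
Proof.
rewrite !rook_placementE.
have -> : [forall i, forall j, ((i, j) \in pad_col C R) ==> (j < add_col lam i)%N] =
          [forall i, forall j, ((i, j) \in R) ==> (j < lam i)%N].
  apply: eq_forallb => i; rewrite (forall_lift ord0) add_colE implybT.
  by apply: eq_forallb => j; rewrite mem_pad_col_lift lift0.
have -> : [forall i, #|row_rooks (pad_col C R) i| <= 1]%N =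
          [forall i, #|row_rooks R i| <= 1]%N && (C \subset free_rows R).
  apply/forallP/andP => [row_le1 | [/forallP row_le1 /subsetP freeC] i].
    split.
      apply/forallP => i; apply: leq_trans (row_le1 i).
      by rewrite card_row_rooks_pad_col leq_addl.
    apply/subsetP => i iC; have := row_le1 i.
    by rewrite card_row_rooks_pad_col iC ltnS leqn0 inE.
  rewrite card_row_rooks_pad_col; case iC: (i \in C); last exact: row_le1.
  by have := freeC i iC; rewrite inE => /eqP ->.
rewrite (forall_lift ord0) col_rooks_pad_col0.
have -> : [forall j, #|col_rooks (pad_col C R) (lift ord0 j)| <= 1]%N =
          [forall j, #|col_rooks R j| <= 1]%N.
  by apply: eq_forallb => j; rewrite col_rooks_pad_col_lift.
by rewrite -!andbA; do !bool_congr.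
Qed.

(** A cell of the new column is to the left of a rook unless its row is free in
    [R], and it is at or below the new rook unless it lies above all of [C]. *)
Lemma card_crosses_add_col r c (lam : {ffun 'I_r -> 'I_c.+1}) (C : {set 'I_r}) R :
  C \subset free_rows R ->
  #|crosses (add_col lam) (pad_col C R)| =
  (#|[set i in free_rows R | [forall k in C, (k < i)%N]]| + #|crosses lam R|)%N.
Proof.
move=> freeC; rewrite (card_split_col ord0); congr addn.
  apply: eq_card => i.
  rewrite [LHS]inE mem_crosses [RHS]in_set /= add_colE mem_pad_col0 /=.
  have -> : left_of_rook (pad_col C R) (i, ord0) = (i \notin free_rows R).
    rewrite /left_of_rook (exists_lift ord0) /= inE cards_eq0.
    apply/existsP/set0Pn => -[j].
      by rewrite mem_pad_col_lift => Rij; exists j; rewrite inE.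
    by rewrite inE => Rij; exists j; rewrite mem_pad_col_lift.
  rewrite negbK; case: (i \in free_rows R); rewrite ?andbF ?andbT //=.
  rewrite /below_rook negb_exists.
  apply/andP/'forall_implyP => [[iC /forallP below] k kC | low].
    have := below k; rewrite mem_pad_col0 kC andbT /= -leqNgt leq_eqVlt.
    case/orP=> [/eqP/val_inj ki|//].
    by rewrite -ki kC in iC.
  split; first by apply/negP => /low; rewrite ltnn.
  apply/forallP => k; rewrite mem_pad_col0 /= negb_and orbC -implybE.
  by apply/implyP => /low/ltnW; rewrite -leqNgt.
apply: eq_card => -[i j].
rewrite inE !mem_crosses /fst /snd add_colE lift0 mem_pad_col_lift.
congr [&& _, _, ~~ _ & ~~ _].
  by apply: eq_existsb => i'; rewrite mem_pad_col_lift.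
rewrite /left_of_rook (exists_lift ord0).
by apply: eq_existsb => j'; rewrite mem_pad_col_lift /snd !lift0.
Qed.

End Diagrams.

(** * The q-Weyl relation and normal ordering *)

Section NormalOrdering.

Variables (K : fieldType) (V : lmodType K) (q y : K) (A B : {linear V -> V}) (v : V).
Let p : K := (1 - q) / q ^+ 2.
Hypothesis commAB : forall x, A (B x) = q *: B (A x) + p *: x.
Hypothesis Av : A v = v.

(** B^k v is an eigenvector of A up to a multiple of B^(k-1) v, as for the
    q-oscillator; at k = 0 the sum vanishes, so the exponent [k.-1] is harmless. *)
Lemma lower_iter k :
  A (iter k B v) = q ^+ k *: iter k B v + (p * \sum_(j < k) q ^+ j) *: iter k.-1 B v.
Proof.
elim: k => [|k IHk] /=.
  by rewrite Av big_ord0 mulr0 scale0r addr0 expr0 scale1r.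
have -> : (p * \sum_(j < k.+1) q ^+ j) *: iter k B v =
    q *: ((p * \sum_(j < k) q ^+ j) *: B (iter k.-1 B v)) + p *: iter k B v.
  rewrite big_ord_recl expr0 mulrDr mulr1 addrC scalerDl; congr (_ + _).
  case: k {IHk} => [|k] /=; first by rewrite !big_ord0 !mulr0 !scale0r scaler0.
  rewrite scalerA mulrCA; congr (_ * _ *: _); rewrite mulr_sumr.
  by apply: eq_bigr => j _; rewrite -exprS.
rewrite commAB IHk linearD !linearZ /= scalerDr !scalerA -exprS.
by rewrite [q * _]mulrC addrA.
Qed.

(** The numbers of elements of [F] above its successive elements, from top to
    bottom, are 0, 1, ..., #|F| - 1. *)
Lemma sum_expr_card_above n (F : {set 'I_n}) :
  \sum_(i in F) q ^+ #|[set k in F | (i < k)%N]| = \sum_(j < #|F|) q ^+ j.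
Proof.
move: {2}#|F| (leqnn #|F|) => m; elim: m F => [|m IHm] F.
  by rewrite leqn0 cards_eq0 => /eqP ->; rewrite cards0 big_ord0 big_set0.
case: (set_0Vmem F) => [-> _|[i0 Fi0] leFm].
  by rewrite cards0 big_ord0 big_set0.
(* The least element has all others above it, and is above none of them. *)
case: (arg_minnP (fun i : 'I_n => i : nat) Fi0) => i Fi min_i.
have cardF := cardsD1 i F; rewrite [i \in F]Fi add1n in cardF.
have aboveE k : k \in F -> [set l in F | (k < l)%N] = [set l in F :\ i | (k < l)%N].
  move=> Fk; apply/setP => l; rewrite !inE; case: (altP (l =P i)) => // ->.
  by rewrite ltnNge min_i // andbF.
rewrite (big_setD1 i) //= cardF big_ord_recr /= addrC; congr (_ + _).
  rewrite -IHm; last by rewrite -ltnS -cardF.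
  by apply: eq_bigr => k /setD1P[_ Fk]; rewrite aboveE.
congr (_ ^+ _); rewrite aboveE //; apply: eq_card => l.
rewrite !inE; case: (altP (l =P i)) => //= li; case Fl: (l \in F) => //=.
by rewrite ltn_neqAle min_i // andbT eq_sym.
Qed.

(** The ways of filling a full left column, when [F] is the set of free rows,
    add up to one application of A. *)
Lemma sum_column n (F : {set 'I_n}) :
  \sum_(C : {set 'I_n} | (C \subset F) && (#|C| <= 1)%N)
     (p ^+ #|C| * q ^+ #|[set i in F | [forall k in C, (k < i)%N]]|)
       *: iter (#|F| - #|C|) B v
  = A (iter #|F| B v).
Proof.
(* The empty column gives the first term of [lower_iter], the single rooks the
   second. *)
rewrite lower_iter (bigD1 set0) ?sub0set ?cards0 //=; congr (_ + _).
  rewrite expr0 mul1r subn0; congr (q ^+ _ *: _).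
  apply: eq_card => i; rewrite inE andbC.
  by have -> : [forall k in (set0 : {set 'I_n}), (k < i)%N]
    by apply/forall_inP => k; rewrite inE.
rewrite -sum_expr_card_above mulr_sumr scaler_suml.
rewrite (eq_bigl (mem [set [set i] | i in F])) => [|C]; last first.
  apply/idP/imsetP => [/andP[/andP[CF C1] C0] | [i Fi ->]]; last first.
    by rewrite sub1set Fi cards1 -cards_eq0 cards1.
  have /cards1P[i Ci] : #|C| == 1%N by rewrite eqn_leq C1 card_gt0.
  by exists i => //; rewrite -sub1set -Ci.
rewrite big_imset /=; last by move=> i j _ _; apply: set1_inj.
apply: eq_bigr => i _; rewrite cards1 expr1 subn1.
congr (p * q ^+ _ *: _); apply: eq_card => k; rewrite !inE.
congr (_ && _); apply/forall_inP/idP => [|ik l]; first by apply; rewrite set11.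
by rewrite inE => /eqP ->.
Qed.

(** The normally ordered form, applied to v, of the word whose boundary path is
    that of [lam]. *)
Definition shape_vector r c (lam : {ffun 'I_r -> 'I_c.+1}) : V :=
  \sum_(R | rook_placement lam R) weight q y lam R *: iter #|free_rows R| B v.

Lemma shape_vector_add_row r c (lam : {ffun 'I_r -> 'I_c.+1}) :
  shape_vector (add_row lam) = B (shape_vector lam).
Proof.
rewrite /shape_vector linear_sum /=.
rewrite (reindex_onto (@pad_row r c) (fun R => [set x | (lift ord_max x.1, x.2) \in R])) /=;
  last exact: pad_row_restrict.
apply: eq_big => R.
  rewrite rook_placement_add_row andbC; case: eqP => // -[]; apply/setP => -[i j].
  by rewrite inE mem_pad_row_lift.
rewrite rook_placement_add_row => /andP[plR _].
rewrite linearZ /= -iterS /weight card_pad_row card_crosses_add_row; congr (_ *: iter _ B v).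
have plR' : rook_placement (add_row lam) (pad_row R) by rewrite rook_placement_add_row.
have := card_free_rows plR'; rewrite card_pad_row -[in RHS](card_free_rows plR) -addnS.
by move=> /addnI.
Qed.

Lemma shape_vector_add_col r c (lam : {ffun 'I_r -> 'I_c.+1}) :
  shape_vector (add_col lam) = y *: A (shape_vector lam).
Proof.
rewrite /shape_vector linear_sum scaler_sumr.
rewrite (reindex (fun z : {set 'I_r * 'I_c} * {set 'I_r} => pad_col z.2 z.1)) /=; last first.
  exists (fun R : {set 'I_r * 'I_c.+1} =>
    ([set x | (x.1, lift ord0 x.2) \in R], col_rooks R ord0)) => [[R C] _|R _].
    by rewrite /= pad_col_restrict col_rooks_pad_col0.
  exact: pad_colK.
under eq_bigl do rewrite rook_placement_add_col.
rewrite -(pair_big_dep (rook_placement lam)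
  (fun R (C : {set 'I_r}) => (C \subset free_rows R) && (#|C| <= 1)%N)
  (fun R C => weight q y (add_col lam) (pad_col C R)
    *: iter #|free_rows (pad_col C R)| B v)) /=.
apply: eq_bigr => R plR; rewrite linearZ /= -sum_column !scaler_sumr.
apply: eq_bigr => C plC; have plCR : rook_placement (add_col lam) (pad_col C R).
  by rewrite rook_placement_add_col plR plC.
have -> : #|free_rows (pad_col C R)| = (#|free_rows R| - #|C|)%N.
  have := card_free_rows plCR; rewrite -[in RHS](card_free_rows plR) card_pad_col.
  by rewrite addnAC addnC => /addnI <-; rewrite addKn.
case/andP: plC => CF _; rewrite /weight card_pad_col card_crosses_add_col //.
rewrite !scalerA -/p !exprD exprS; congr (_ *: _); ring.
Qed.

Definition rook_vector r c : V :=
  \sum_(lam : {ffun 'I_r -> 'I_c.+1} | young lam) shape_vector lam.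

Lemma rook_vector_top_empty r c :
  \sum_(lam : {ffun 'I_r.+1 -> 'I_c.+1} | young lam && (lam ord_max == ord0))
    shape_vector lam = B (rook_vector r c).
Proof.
rewrite linear_sum /=.
rewrite (reindex_onto (@add_row r c) (fun mu => [ffun i => mu (lift ord_max i)])) /=.
  apply: eq_big => lam; last by rewrite shape_vector_add_row.
  rewrite young_add_row add_row_max eqxx andbT; case: eqP; rewrite ?andbT // => -[].
  by apply/ffunP => i; rewrite ffunE add_row_lift.
move=> mu /andP[_ /eqP mu0]; apply/ffunP => i.
by case: (unliftP ord_max i) => [k|] ->; rewrite ?add_row_lift ?add_row_max // ffunE.
Qed.

Lemma rook_vector_full_column r c :
  \sum_(lam : {ffun 'I_r -> 'I_c.+2} | young lam && [forall i, lam i != ord0])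
    shape_vector lam = y *: A (rook_vector r c).
Proof.
rewrite linear_sum scaler_sumr /=.
rewrite (reindex_onto (@add_col r c) (fun mu => [ffun i => odflt ord0 (unlift ord0 (mu i))])) /=.
  apply: eq_big => lam; last by rewrite shape_vector_add_col.
  rewrite young_add_col.
  have -> : [forall i, add_col lam i != ord0] by apply/forallP => i; rewrite ffunE.
  rewrite andbT; case: eqP; rewrite ?andbT // => -[].
  by apply/ffunP => i; rewrite !ffunE liftK.
move=> mu /andP[_ /forallP mu0]; apply/ffunP => i; rewrite !ffunE.
by case: unliftP (mu0 i) => [k|] -> //=; rewrite eqxx.
Qed.

Lemma rook_vector00 : rook_vector 0 0 = v.
Proof.
rewrite /rook_vector (big_pred1 [ffun=> ord0]) => [|lam]; last first.
  have -> : lam = [ffun=> ord0] by apply/ffunP => -[].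
  by rewrite /= eqxx; apply/forallP => -[].
rewrite /shape_vector (big_pred1 set0) => [|R]; last first.
  have -> : R = set0 by apply/setP => -[[]].
  by rewrite /= eqxx rook_placementE; apply/and3P; split; apply/forallP => -[].
rewrite /weight cards0 !card_sum_mem !big1 ?scale1r; try by move=> -[].
  by rewrite !expr0 !mulr1 scale1r.
by move=> -[[]].
Qed.

Lemma rook_vector0S c : rook_vector 0 c.+1 = y *: A (rook_vector 0 c).
Proof.
rewrite -rook_vector_full_column; apply: eq_bigl => lam.
by rewrite andbC; case: forallP => // -[] [].
Qed.

Lemma rook_vectorS0 r : rook_vector r.+1 0 = B (rook_vector r 0).
Proof.
rewrite -rook_vector_top_empty; apply: eq_bigl => lam.
by rewrite (ord1 (lam ord_max)) eqxx andbT.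
Qed.

(** Since row lengths decrease upwards, the complement of the diagrams with an
    empty top row consists of those whose left column is full. *)
Lemma rook_vectorSS r c :
  rook_vector r.+1 c.+1 = B (rook_vector r c.+1) + y *: A (rook_vector r.+1 c).
Proof.
rewrite -rook_vector_top_empty -rook_vector_full_column.
rewrite /rook_vector (bigID (fun lam : {ffun _ -> _} => lam ord_max == ord0)) /=.
congr (_ + _); apply: eq_bigl => lam.
case yl: (young lam) => //=; apply/idP/forallP => [top i | /(_ ord_max)//].
have := implyP (forallP (forallP yl i) ord_max) (leq_ord i).
by rewrite -!val_eqE /= -!lt0n in top *; apply: leq_trans.
Qed.

(** The diagrams of half-perimeter n.+1 are split by the first step of their
    boundary; with no row or no column that step is forced, so the two extreme
    summands are set apart from the others. *)
Lemma iter_rook_vector n :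
  iter n ((y \*: A) \+ B) v = \sum_(r < n.+1) rook_vector r (n - r).
Proof.
elim: n => [|n IHn]; first by rewrite big_ord1 rook_vector00.
rewrite iterS {}IHn [RHS]big_ord_recl [X in _ = _ + X]big_ord_recr /= subn0 subnn.
rewrite rook_vector0S rook_vectorS0.
under [X in _ = _ + (X + _)]eq_bigr => i _ do
  rewrite /bump /= add1n subSS -(subnSK (ltn_ord i)) rook_vectorSS.
rewrite big_split /= [X in _ = _ + X]addrAC [X in _ = _ + X]addrC [RHS]addrA.
congr (_ + _).
  rewrite big_ord_recl /= linearD scalerDr subn0; congr (_ + _).
  by rewrite linear_sum scaler_sumr.
rewrite big_ord_recr /= subnn linearD linear_sum; congr (_ + _).
by apply: eq_bigr => i _; rewrite subnSK.
Qed.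

End NormalOrdering.

(** * The matrix product *)

Lemma indet_q_neq0 : indet_q != 0.
Proof. by rewrite tofrac_eq0 polyC_eq0 polyX_eq0. Qed.

Theorem proposition6
    (K : fieldType) (iota : {rmorphism Qqy -> K}) (V : lmodType K)
    (D E : {linear V -> V}) (W : {scalar V}) (v : V) :
  let q : K := iota indet_q in
  let y : K := iota indet_y in
  (D \o E) \- (q \*: (E \o D)) =1 D \+ E ->
  W \o E =1 W ->
  D v = v ->
  W v = 1 ->
  forall n : nat,
    W (iter n ((y \*: hat_op q D) \+ hat_op q E) v) = rook_sum q y n.
Proof.
move=> q y commDE WE Dv Wv n.
have q0 : q != 0 by rewrite fmorph_eq0 indet_q_neq0.
pose A : {linear V -> V} := ((q - 1) / q \*: D) \+ (1 / q \*: idfun).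
pose B : {linear V -> V} := ((q - 1) / q \*: E) \+ (1 / q \*: idfun).
have Av : A v = v.
  rewrite /A /= Dv -scalerDl -[RHS]scale1r; congr (_ *: _).
  by field.
have WB x : W (B x) = W x.
  rewrite /B /= linearD !linearZ /= [W (E x)]WE; by field.
(* The coefficients of D x and E x cancel, because (q - 1) / q + (1 - q) / q = 0. *)
have commAB x : A (B x) = q *: B (A x) + ((1 - q) / q ^+ 2) *: x.
  have /eqP := commDE x; rewrite /= subr_eq => /eqP DEx.
  rewrite /A /B /= !linearD !linearZ /= DEx !scalerDr !scalerA.
  rewrite [LHS](AC (4*2) (3*(1*4)*(2*5)*6)) [RHS](AC (2*2*1) (1*3*2*(4*5))) /=.
  by rewrite -!scalerDl; congr (_ *: _ + _ *: _ + _ *: _ + _ *: _); field.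
have Witer k : W (iter k B v) = 1 by elim: k => //= k IHk; rewrite WB.
transitivity (W (\sum_(r < n.+1) rook_vector q y B v r (n - r))).
  by rewrite -(iter_rook_vector y commAB Av).
rewrite linear_sum; apply: eq_bigr => r _.
rewrite (big_pred1 (inord (n - r))) => [|c]; last first.
  rewrite /= -val_eqE /= inordK ?ltnS ?leq_subr //.
  by rewrite -[RHS](eqn_add2l r) subnKC // -ltnS.
rewrite /= inordK ?ltnS ?leq_subr // linear_sum; apply: eq_bigr => lam _.
rewrite linear_sum; apply: eq_bigr => R _; by rewrite linearZ /= Witer mulr1.
Qed.
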